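(* Let $m\ge 0$ be an integer, $q=2^{2m+1}$, and let $Sz(q)={}^2\mathsf{C}_2(q)$ be the Suzuki group, with its Sylow $2$-subgroups $U$ and $U^-=wUw^{-1}$. Then $$Sz(q)=U\,U^-\,U\,U^-,$$ i.e. every element of $Sz(q)$ is a product $u_1v_1u_2v_2$ with $u_1,u_2\in U$ and $v_1,v_2\in U^-$.
   Context: Let $F=\mathbb{F}_q$, $q=2^{2m+1}$, and $\theta=2^m$, so that $q=2\theta^2$. Rows and columns of $4\times4$ matrices are indexed, in this order, by $1,2,-2,-1$. $Sp(4,F)$ is the subgroup of $GL(4,F)$ preserving the symplectic form with matrix $(\delta_{i,-j})$. Let $e$ be the identity matrix and $e_{ij}$ the matrix units. For $\xi\in F$ put $T_{ij}(\xi)=T_{-j,-i}(\xi)=e+\xi e_{ij}+\xi e_{-j,-i}$ for $i\ne\pm j$, and $T_{i,-i}(\xi)=e+\xi e_{i,-i}$. With $\alpha,\beta$ the simple roots of $\mathsf{C}_2$ ($\alpha$ short, $\beta$ long), the root elements for positive roots are $x_\alpha(\xi)=T_{1,2}(\xi)$, $x_\beta(\xi)=T_{2,-2}(\xi)$, $x_{\alpha+\beta}(\xi)=T_{1,-2}(\xi)$, $x_{2\alpha+\beta}(\xi)=T_{1,-1}(\xi)$, and those for the negative roots are the transposes. Let $\gamma\mapsto\overline{\gamma}$ be the permutation of the roots with $\alpha\leftrightarrow\beta$, $\alpha+\beta\leftrightarrow2\alpha+\beta$, and $\overline{-\gamma}=-\overline{\gamma}$. The exceptional automorphism $\sigma$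 of $Sp(4,F)$ is defined by $\sigma(x_\gamma(\xi))=x_{\overline{\gamma}}(\xi^{\lambda(\overline{\gamma})\theta})$ for all roots $\gamma$, where $\lambda(\gamma)=1$ if $\gamma$ is short and $\lambda(\gamma)=2$ if $\gamma$ is long. The Suzuki group is $Sz(q)={}^2\mathsf{C}_2(2^{2m+1})=\{g\in Sp(4,F)\mid\sigma(g)=g\}$. For $t,u\in F$ put $$x_+(t,u)=x_\alpha(t^\theta)x_\beta(t)x_{\alpha+\beta}(t^{\theta+1}+u)x_{2\alpha+\beta}(u^{2\theta})=\begin{pmatrix}1&t^\theta&u&t^{2\theta+1}+t^\theta u+u^{2\theta}\\0&1&t&t^{\theta+1}+u\\0&0&1&t^\theta\\0&0&0&1\end{pmatrix}.$$ Let $U=\{x_+(t,u)\mid t,u\in F\}$; it is a Sylow $2$-subgroup of $Sz(q)$. Let $w$ be the $4\times 4$ matrix with all entries $1$ on the antidiagonal and $0$ elsewhere (so $w^2=e$ and $w\in Sz(q)$), and let $U^-=\{w\,x_+(t,u)\,w\mid t,u\in F\}=wUw^{-1}$, again a Sylow $2$-subgroup. Equivalently (Bruhat decomposition, which can be taken as the definition), with $h(\varepsilon)=\operatorname{diag}(\varepsilon,\varepsilon^{2\theta-1},\varepsilon^{1-2\theta},\varepsilon^{-1})$ for $\varepsilon\in F^*$, $Sz(q)$ is the set of all matrices of one of the forms $x_+(t_1,u_1)h(\varepsilon)w\,x_+(t_2,u_2)$ or $x_+(t,u)h(\varepsilon)$, with $t,u,t_i,u_i\in F$, $\varepsilon\in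 F^*$, each element being written uniquely in exactly one of these forms. *)

(* Defs.v *)
From HB Require Import structures.
From mathcomp Require Import all_boot all_order all_algebra all_fingroup.
From mathcomp Require Import ring.

Set Implicit Arguments.
Unset Strict Implicit.
Unset Printing Implicit Defensive.

Import GRing.Theory.
Local Open Scope ring_scope.

(* Rows and columns are indexed, in this order, by 1, 2, -2, -1, so that the
   negation of an index is [rev_ord]. *)
Definition i1 : 'I_4 := @Ordinal 4 0 isT.
Definition i2 : 'I_4 := @Ordinal 4 1 isT.
Definition im2 : 'I_4 := @Ordinal 4 2 isT.
Definition im1 : 'I_4 := @Ordinal 4 3 isT.

Definition theta (m : nat) : nat := (2 ^ m)%N.

Section SuzukiDefs.

Variable F : finFieldType.

Definition symp_form : 'M[F]_4 := \matrix_(i, j) (i == rev_ord j)%:R.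

Definition Sp4_set : {set {'GL_4[F]}} :=
  [set g : {'GL_4[F]} | (GLval g)^T *m symp_form *m GLval g == symp_form].

Lemma Sp4_group_set : group_set Sp4_set.
Proof.
apply/group_setP; split=> [|g h].
  by rewrite inE GL_1E trmx1 mul1mx mulmx1.
rewrite !inE GL_MxE trmx_mul => /eqP gJ /eqP hJ.
by rewrite !mulmxA -(mulmxA _ _ symp_form) -(mulmxA _ _ (GLval g)) gJ hJ.
Qed.
Canonical Sp4 : {group {'GL_4[F]}} := Group Sp4_group_set.

Definition T_mx (i j : 'I_4) (xi : F) : 'M[F]_4 :=
  if j == rev_ord i then 1%:M + xi *: delta_mx i j
  else 1%:M + xi *: delta_mx i j + xi *: delta_mx (rev_ord j) (rev_ord i).

End SuzukiDefs.

(* alpha and alpha + beta are short, beta and 2 alpha + beta are long. *)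
Inductive proot := Alpha | Beta | AlphaBeta | TwoAlphaBeta.

Inductive root_C2 := Pos of proot | Neg of proot.

Definition pbar (g : proot) : proot :=
  match g with
  | Alpha => Beta
  | Beta => Alpha
  | AlphaBeta => TwoAlphaBeta
  | TwoAlphaBeta => AlphaBeta
  end.

Definition rbar (g : root_C2) : root_C2 :=
  match g with Pos g' => Pos (pbar g') | Neg g' => Neg (pbar g') end.

Definition plambda (g : proot) : nat :=
  match g with Alpha | AlphaBeta => 1 | Beta | TwoAlphaBeta => 2 end.

Definition rlambda (g : root_C2) : nat :=
  match g with Pos g' | Neg g' => plambda g' end.

Section SuzukiGroup.

Variable F : finFieldType.

Definition x_pos (g : proot) (xi : F) : 'M[F]_4 :=
  match g with
  | Alpha => T_mx i1 i2 xi
  | Beta => T_mx i2 im2 xi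
  | AlphaBeta => T_mx i1 im2 xi
  | TwoAlphaBeta => T_mx i1 im1 xi
  end.

Definition x_root (g : root_C2) (xi : F) : 'M[F]_4 :=
  match g with Pos g' => x_pos g' xi | Neg g' => (x_pos g' xi)^T end.

(* The automorphism sigma is unique, as the root elements generate Sp4.
   Elements of [Aut Sp4] are permutations of {'GL_4[F]} that are the identity
   outside Sp4. *)
Definition exceptional_aut (m : nat) (sigma : {perm {'GL_4[F]}}) : Prop :=
  sigma \in Aut (Sp4 F) /\
  forall (g : root_C2) (xi : F) (x : {'GL_4[F]}),
    GLval x = x_root g xi ->
    GLval (sigma x) = x_root (rbar g) (xi ^+ (rlambda (rbar g) * theta m)).

Definition Sz (sigma : {perm {'GL_4[F]}}) : {set {'GL_4[F]}} :=
  [set g in Sp4 F | sigma g == g].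

Definition x_plus (m : nat) (t u : F) : 'M[F]_4 :=
  x_pos Alpha (t ^+ theta m) *m x_pos Beta t
  *m x_pos AlphaBeta (t ^+ (theta m).+1 + u)
  *m x_pos TwoAlphaBeta (u ^+ (2 * theta m)).

Definition w_mx : 'M[F]_4 := \matrix_(i, j) (j == rev_ord i)%:R.

Definition U_plus (m : nat) : {set {'GL_4[F]}} :=
  [set g : {'GL_4[F]} | [exists t, exists u, GLval g == x_plus m t u]].

Definition U_minus (m : nat) : {set {'GL_4[F]}} :=
  [set g : {'GL_4[F]} | [exists t, exists u, GLval g == w_mx *m x_plus m t u *m w_mx]].

(* Sanity checks: root elements are symplectic matrices (so the condition in
   [exceptional_aut] concerns all of them), and [x_plus] has the expected
   matrix. *)

Definition mx4 (s : seq (seq F)) : 'M[F]_4 :=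
  \matrix_(i, j) nth 0 (nth [::] s i) j.

Lemma x_posE (g : proot) (xi : F) :
  x_pos g xi = mx4 match g with
  | Alpha => [:: [:: 1; xi; 0; 0]; [:: 0; 1; 0; 0];
                 [:: 0; 0; 1; xi]; [:: 0; 0; 0; 1]]
  | Beta => [:: [:: 1; 0; 0; 0]; [:: 0; 1; xi; 0];
                [:: 0; 0; 1; 0]; [:: 0; 0; 0; 1]]
  | AlphaBeta => [:: [:: 1; 0; xi; 0]; [:: 0; 1; 0; xi];
                     [:: 0; 0; 1; 0]; [:: 0; 0; 0; 1]]
  | TwoAlphaBeta => [:: [:: 1; 0; 0; xi]; [:: 0; 1; 0; 0];
                        [:: 0; 0; 1; 0]; [:: 0; 0; 0; 1]]
  end.
Proof.
apply/matrixP=> i j; rewrite mxE.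
case: g; rewrite /x_pos /T_mx /= !mxE;
  case: i => [[|[|[|[|//]]]] ?]; case: j => [[|[|[|[|//]]]] ?] /=;
  by rewrite ?(mulr0, mulr1, add0r, addr0).
Qed.

Let ent (s : seq (seq F)) i j : F := nth 0 (nth [::] s i) j.

Lemma mx4M (s t : seq (seq F)) :
  mx4 s *m mx4 t = mx4 (mkseq (fun i => mkseq (fun j =>
    ent s i 0 * ent t 0 j + (ent s i 1 * ent t 1 j +
    (ent s i 2 * ent t 2 j + ent s i 3 * ent t 3 j))) 4) 4).
Proof.
apply/matrixP=> i j; rewrite !mxE !big_ord_recl big_ord0 addr0 !mxE.
by rewrite nth_mkseq // nth_mkseq.
Qed.

Lemma mx4T (s : seq (seq F)) :
  (mx4 s)^T = mx4 (mkseq (fun i => mkseq (fun j => ent s j i) 4) 4).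
Proof. by apply/matrixP=> i j; rewrite !mxE nth_mkseq // nth_mkseq. Qed.

Lemma symp_formE : symp_form F = mx4
  [:: [:: 0; 0; 0; 1]; [:: 0; 0; 1; 0]; [:: 0; 1; 0; 0]; [:: 1; 0; 0; 0]].
Proof.
apply/matrixP=> i j; rewrite !mxE.
by case: i => [[|[|[|[|//]]]] ?]; case: j => [[|[|[|[|//]]]] ?].
Qed.

Let simp01 := (mulr0, mul0r, mulr1, mul1r, add0r, addr0).

Lemma x_root_Sp4 (char2 : 2%N \in [pchar F]) (g : root_C2) (xi : F) :
  exists2 x : {'GL_4[F]}, x \in Sp4 F & GLval x = x_root g xi.
Proof.
pose f := symp_form F.
have ff : f *m f = 1%:M.
  rewrite /f symp_formE mx4M /mkseq /ent /= !simp01.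
  apply/matrixP=> i j; rewrite !mxE.
  by case: i => [[|[|[|[|//]]]] ?]; case: j => [[|[|[|[|//]]]] ?].
have fP : (x_root g xi)^T *m f *m x_root g xi = f.
  have fpos p : (x_pos p xi)^T *m f *m x_pos p xi = f /\
                x_pos p xi *m f *m (x_pos p xi)^T = f.
    rewrite x_posE /f symp_formE mx4T; case: p;
    by rewrite /mkseq /= !mx4M /mkseq /ent /= !simp01 ?addrr_pchar2.
  by case: g => p; rewrite /= ?trmxK; case: (fpos p).
have ux : x_root g xi \is a GRing.unit.
  have [] // := @mulmx1_unit _ _ (f *m (x_root g xi)^T *m f) (x_root g xi).
  by rewrite -!mulmxA (mulmxA _ f) fP ff.
by exists (Sub (x_root g xi) ux); rewrite // inE fP.
Qed.

Lemma x_plusE (char2 : 2%N \in [pchar F]) (m : nat) (t u : F) :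
  let th := theta m in
  x_plus m t u = mx4
    [:: [:: 1; t ^+ th; u;
            t ^+ (2 * th).+1 + t ^+ th * u + u ^+ (2 * th)];
        [:: 0; 1; t; t ^+ th.+1 + u];
        [:: 0; 0; 1; t ^+ th];
        [:: 0; 0; 0; 1]].
Proof.
rewrite /x_plus !x_posE !mx4M /mkseq /ent /= !simp01.
set a := t ^+ theta m.
have e13 : t ^+ (theta m).+1 + u + a * t = u.
  by rewrite exprSr addrC addrA addrr_pchar2 // add0r.
have e14 : u ^+ (2 * theta m) + a * (t ^+ (theta m).+1 + u) =
           t ^+ (2 * theta m).+1 + a * u + u ^+ (2 * theta m).
  by rewrite mul2n -addnn !exprS !exprD -/a; ring.
by rewrite -e14 e13.
Qed.

End SuzukiGroup.

(* Main.v *)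
Require Import Defs.
From HB Require Import structures.
From mathcomp Require Import all_boot all_order all_algebra all_fingroup.
From mathcomp Require Import finfield ring.

(** The automorphism sigma is given only by its values on root elements, so it
    must first be made explicit. Sending a symplectic matrix to its 2 x 2 minors
    on the four index pairs other than {1, -1} and {2, -2} is multiplicative in
    characteristic two ([minorsM]), and composing it with x |-> x^theta gives
    the prescribed values on root elements ([minors_root]). As the root elements
    generate Sp(4) ([Sp4_sub_roots], by elimination), sigma is this composite.
    Hence g in Sp(4) lies in Sz(q) if and only if its matrix of minors is
    obtained from g by raising the entries to the power 2 theta ([mem_Sz]).

    These equations replace the Bruhat decomposition. They show that U is the
    stabilizer of the first basis vector e_1 in Sz(q) ([mem_U]), and that the
    first column of an element of Sz(q) satisfies the equation of the
    Suzuki-Tits ovoid ([ovoid_eq]). If its last coordinate c is not zero, then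
    the column is c times the last column of an element of U ([ovoid_U]).
    Therefore two elements of Sz(q) with the same nonzero entry c in the lower
    left corner lie in the same double coset of U ([same_corner]).

    The corner entry of w x_+(0, u) w is u^(2 theta), and u |-> u^(2 theta) is
    bijective on F. So every element of Sz(q) with nonzero corner entry is in
    U U^- U ([corner_UVU]). Finally every element of Sz(q) acquires a nonzero
    corner entry when multiplied on the right by a suitable element of U^-
    ([corner_neq0]). *)

Set Implicit Arguments.
Unset Strict Implicit.
Unset Printing Implicit Defensive.

Import GRing.Theory.
Local Open Scope ring_scope.

(** * Matrices of size four in characteristic two *)

Lemma ord4P (P : 'I_4 -> Prop) :
  P i1 -> P i2 -> P im2 -> P im1 -> forall i, P i.
Proof.
move=> P1 P2 P3 P4 i; case: i => [[|[|[|[|//]]]] ?].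
- by rewrite (_ : Ordinal _ = i1) //; apply: val_inj.
- by rewrite (_ : Ordinal _ = i2) //; apply: val_inj.
- by rewrite (_ : Ordinal _ = im2) //; apply: val_inj.
- by rewrite (_ : Ordinal _ = im1) //; apply: val_inj.
Qed.

Lemma sum_ord4 (V : nmodType) (f : 'I_4 -> V) :
  \sum_i f i = f i1 + f i2 + f im2 + f im1.
Proof.
rewrite !big_ord_recl big_ord0 addr0 !addrA.
by congr (f _ + f _ + f _ + f _); apply: val_inj.
Qed.

Section Suzuki.

Variable F : finFieldType.
Hypothesis char2 : 2%N \in [pchar F].

Implicit Types (A B : 'M[F]_4) (g h : {'GL_4[F]}) (x y t u : F).

Let simp01 := (mulr0, mul0r, mulr1, mul1r, add0r, addr0).

(** With this equation as a rewrite rule, [ring] cancels doubled terms. It still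
    keeps x and - x apart, hence the minors and relations below are written with
    sums only. *)
Lemma two_eq0 : 2%:R = 0 :> F.
Proof. exact: pcharf0. Qed.

Lemma addrr2 x : x + x = 0.
Proof. exact: addrr_pchar2. Qed.

Lemma addr2_eq0 x y : (x + y == 0) = (x == y).
Proof. by rewrite addr_eq0 oppr_pchar2. Qed.

Lemma mulmx4E A B i j : (A *m B) i j =
  A i i1 * B i1 j + A i i2 * B i2 j + A i im2 * B im2 j + A i im1 * B im1 j.
Proof. by rewrite mxE sum_ord4. Qed.

Lemma symp_col g : g \in Sp4 F -> forall j k,
  GLval g i1 j * GLval g im1 k + GLval g i2 j * GLval g im2 k +
  GLval g im2 j * GLval g i2 k + GLval g im1 j * GLval g i1 k =
  (j == rev_ord k)%:R.
Proof.
rewrite inE => /eqP/matrixP gJ j k; move: (gJ j k).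
rewrite !mulmx4E !mxE /= !simp01 => <-.
ring.
Qed.

(** The transpose of a symplectic matrix is symplectic: since the matrix J of
    the form is its own inverse, J g^T J is a left inverse of g, hence also a
    right inverse. *)
Lemma symp_row g : g \in Sp4 F -> forall j k,
  GLval g j i1 * GLval g k im1 + GLval g j i2 * GLval g k im2 +
  GLval g j im2 * GLval g k i2 + GLval g j im1 * GLval g k i1 =
  (j == rev_ord k)%:R.
Proof.
rewrite inE => /eqP gJ j k.
have JJ : symp_form F *m symp_form F = 1%:M.
  apply/matrixP => {j k}; elim/ord4P; elim/ord4P;
  by rewrite mulmx4E !mxE /= !simp01.
have JgJg : symp_form F *m (GLval g)^T *m symp_form F *m GLval g = 1%:M.
  by rewrite -!mulmxA (mulmxA _ _ (GLval g)) gJ JJ.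
have gJg : GLval g *m symp_form F *m (GLval g)^T = symp_form F.
  move/mulmx1C: JgJg; rewrite !mulmxA => /(congr1 (mulmx^~ (symp_form F))).
  by rewrite mul1mx -[_ *m _ *m symp_form F]mulmxA JJ mulmx1.
move/matrixP: gJg => /(_ j k).
rewrite !mulmx4E !mxE /= !simp01 => <-.
ring.
Qed.

(** * The root elements generate the symplectic group *)

Section Generation.

Variable H : {group {'GL_4[F]}}.
Hypothesis rootH : forall gm xi g, GLval g = x_root gm xi -> g \in H.

(** Gaussian elimination: membership in H is unchanged by the row operation
    that left multiplication by a root element performs, so it is enough to
    clear the columns of g one after the other. *)
Lemma root_step gm xi g : g \in Sp4 F ->
  exists g', [/\ g' \in Sp4 F, GLval g' = x_root gm xi *m GLval g
                & g' \in H -> g \in H].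
Proof.
move=> gS; have [x xS xE] := x_root_Sp4 char2 gm xi.
exists (x * g)%g; split; first exact: groupM.
  by rewrite GL_MxE xE.
by rewrite groupMl // (rootH xE).
Qed.

Let rowE := (mulmx4E, x_posE, mx4T).

(** By the symplectic relations, fixing the first two basis vectors leaves only
    three free entries, those of a product of root elements for the roots
    beta, alpha + beta and 2 alpha + beta. *)
Lemma fix2_gen g : g \in Sp4 F ->
  (forall i, GLval g i i1 = (i == i1)%:R) ->
  (forall i, GLval g i i2 = (i == i2)%:R) -> g \in H.
Proof.
move=> gS c1 c2; have sp := symp_col gS.
have s1 k : GLval g im1 k = (i1 == rev_ord k)%:R.
  by rewrite -sp !c1 /= !simp01.
have s2 k : GLval g im2 k = (i2 == rev_ord k)%:R.
  by rewrite -sp !c2 /= !simp01.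
have s3 : GLval g i2 im1 = GLval g i1 im2.
  apply/eqP; rewrite -addr2_eq0 addrC; have := sp im2 im1.
  by rewrite !s1 !s2 /= !simp01 => ->.
have [a _ aE] := x_root_Sp4 char2 (Pos Beta) (GLval g i2 im2).
have [b _ bE] := x_root_Sp4 char2 (Pos AlphaBeta) (GLval g i1 im2).
have [c _ cE] := x_root_Sp4 char2 (Pos TwoAlphaBeta) (GLval g i1 im1).
rewrite (_ : g = a * b * c)%g ?groupM ?(rootH aE) ?(rootH bE) ?(rootH cE) //.
have posE p xi : x_root (Pos p) xi = _ := x_posE p xi.
apply: val_inj; rewrite [RHS]GL_MxE GL_MxE aE bE cE !posE.
rewrite !mx4M /mkseq /= !simp01; apply/matrixP.
by elim/ord4P; elim/ord4P; rewrite mxE /= ?c1 ?c2 ?s1 ?s2 ?s3.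
Qed.

Lemma fix1_pivot_gen g : g \in Sp4 F ->
  (forall i, GLval g i i1 = (i == i1)%:R) -> GLval g i2 i2 = 1 -> g \in H.
Proof.
move=> gS c1 g22.
have g42 : GLval g im1 i2 = 0.
  by have := symp_col gS i1 i2; rewrite !c1 /= !simp01.
have [g' [g'S g'E]] := root_step (Neg Beta) (GLval g im2 i2) gS; apply.
have [g'' [g''S g''E]] := root_step (Pos Alpha) (GLval g i1 i2) g'S; apply.
apply: fix2_gen => //.
  by elim/ord4P; rewrite g''E !mulmx4E g'E !rowE !mxE /= !c1 !simp01.
by elim/ord4P; rewrite g''E !mulmx4E g'E !rowE !mxE /= ?g42 ?g22 !simp01
  ?addrr2.
Qed.

(** The second column has a nonzero entry among rows 2 and -2, and the root
    elements for beta and -beta turn its entry in row 2 into 1. *)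
Lemma fix1_gen g : g \in Sp4 F ->
  (forall i, GLval g i i1 = (i == i1)%:R) -> g \in H.
Proof.
have main k : k \in Sp4 F -> (forall i, GLval k i i1 = (i == i1)%:R) ->
    GLval k im2 i2 != 0 -> k \in H.
  move=> kS c1 k32.
  have [k' [k'S k'E]] := root_step (Pos Beta)
    ((1 + GLval k i2 i2) / GLval k im2 i2) kS; apply.
  apply: fix1_pivot_gen => //.
    by elim/ord4P; rewrite k'E !rowE !mxE /= !c1 !simp01.
  by rewrite k'E !rowE !mxE /= !simp01 mulfVK // addrCA addrr2 addr0.
move=> gS c1; have [g32|] := eqVneq (GLval g im2 i2) 0; last exact: main.
have g22 : GLval g i2 i2 != 0.
  have g42 : GLval g im1 i2 = 0.
    by have := symp_col gS i1 i2; rewrite !c1 /= !simp01.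
  apply/eqP=> g22; have := symp_col gS i2 im2; rewrite g22 g32 g42 /=.
  have -> : GLval g im1 im2 = 0.
    by have := symp_col gS i1 im2; rewrite !c1 /= !simp01.
  by move/eqP; rewrite !simp01 eq_sym oner_eq0.
have [g' [g'S g'E]] := root_step (Neg Beta) 1 gS; apply.
apply: main => //.
  by elim/ord4P; rewrite g'E !rowE !mxE /= !c1 !simp01.
by rewrite g'E !rowE !mxE /= g32 !simp01.
Qed.

Lemma pivot_gen g : g \in Sp4 F -> GLval g i1 i1 = 1 -> g \in H.
Proof.
move=> gS g11.
have [a [aS aE]] := root_step (Neg Alpha) (GLval g i2 i1) gS; apply.
have [b [bS bE]] := root_step (Neg AlphaBeta) (GLval g im2 i1) aS; apply.
have [c [cS cE]] := root_step (Neg TwoAlphaBeta) (GLval b im1 i1) bS; apply.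
have b1 i : i != im1 -> GLval b i i1 = (i == i1)%:R.
  by elim/ord4P: i => // _; rewrite bE !mulmx4E aE !rowE !mxE /= !g11 !simp01
     ?addrr2.
apply: fix1_gen => //.
by elim/ord4P; rewrite cE !rowE !mxE /= (b1 i1) ?(b1 i2) ?(b1 im2) //= !simp01
  ?addrr2.
Qed.

(** Whichever entry of the first column is nonzero, at most one row operation
    makes the one in row 2 nonzero, and then alpha gives the pivot 1. *)
Lemma Sp4_sub_roots : Sp4 F \subset H.
Proof.
have main k : k \in Sp4 F -> GLval k i2 i1 != 0 -> k \in H.
  move=> kS nz.
  (* The multiple of row 2 that turns the corner entry into 1. *)
  have [k' [k'S k'E]] := root_step (Pos Alpha)
    ((1 + GLval k i1 i1) / GLval k i2 i1) kS; apply.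
  apply: pivot_gen => //.
  by rewrite k'E !rowE !mxE /= !simp01 mulfVK // addrCA addrr2 addr0.
apply/subsetP=> g gS.
have [g2|] := eqVneq (GLval g i2 i1) 0; last exact: main.
have [g3|nz] := eqVneq (GLval g im2 i1) 0; last first.
  have [k [kS kE]] := root_step (Pos Beta) 1 gS; apply; apply: main => //.
  by rewrite kE !rowE !mxE /= g2 !simp01.
have [g1|nz] := eqVneq (GLval g i1 i1) 0; last first.
  have [k [kS kE]] := root_step (Neg Alpha) 1 gS; apply; apply: main => //.
  by rewrite kE !rowE !mxE /= g2 !simp01.
have nz : GLval g im1 i1 != 0.
  apply/eqP=> g4; have := symp_col gS i1 im1; rewrite g1 g2 g3 g4 /=.
  by move/eqP; rewrite !simp01 eq_sym oner_eq0.
have [k [kS kE]] := root_step (Pos AlphaBeta) 1 gS; apply; apply: main => //.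
by rewrite kE !rowE !mxE /= g2 !simp01.
Qed.

End Generation.

(** * The exceptional isogeny given by 2 x 2 minors *)

(** The index pairs {i, j} other than {1, -1} and {2, -2}. The bivectors of the
    basis that they index span, modulo the invariant bivector, the
    4-dimensional subquotient of the exterior square on which Sp(4) acts
    symplectically in characteristic two; the order matches 1, 2, -2, -1. *)
Definition isoPair (i : 'I_4) : 'I_4 * 'I_4 :=
  nth (i1, i2) [:: (i1, i2); (i1, im2); (i2, im1); (im2, im1)] i.

Definition minor2 A (r c : 'I_4 * 'I_4) : F :=
  A r.1 c.1 * A r.2 c.2 + A r.1 c.2 * A r.2 c.1.

Definition minors A : 'M[F]_4 :=
  \matrix_(i, j) minor2 A (isoPair i) (isoPair j).

(** The Cauchy-Binet formula for these minors has two terms too many, for the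
    column pairs {1, -1} and {2, -2}. The symplectic relations make the two
    equal, so they cancel in characteristic two. *)
Lemma minorsM g h : g \in Sp4 F -> h \in Sp4 F ->
  minors (GLval g *m GLval h) = minors (GLval g) *m minors (GLval h).
Proof.
move=> gS hS; apply/matrixP => i j; rewrite mulmx4E !mxE.
have rg : minor2 (GLval g) (isoPair i) (i1, im1) =
          minor2 (GLval g) (isoPair i) (i2, im2).
  apply/eqP; rewrite -addr2_eq0; apply/eqP.
  have := symp_row gS (isoPair i).1 (isoPair i).2.
  have -> : ((isoPair i).1 == rev_ord (isoPair i).2) = false.
    by elim/ord4P: i.
  by rewrite /minor2 /= => e; rewrite -[RHS]e; ring.
have ch : minor2 (GLval h) (i1, im1) (isoPair j) =
          minor2 (GLval h) (i2, im2) (isoPair j).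
  apply/eqP; rewrite -addr2_eq0; apply/eqP.
  have := symp_col hS (isoPair j).1 (isoPair j).2.
  have -> : ((isoPair j).1 == rev_ord (isoPair j).2) = false.
    by elim/ord4P: j.
  by rewrite /minor2 /= => e; rewrite -[RHS]e; ring.
have CB (r c : 'I_4 * 'I_4) : minor2 (GLval g *m GLval h) r c =
  minor2 (GLval g) r (i1, i2) * minor2 (GLval h) (i1, i2) c +
  minor2 (GLval g) r (i1, im2) * minor2 (GLval h) (i1, im2) c +
  minor2 (GLval g) r (i2, im1) * minor2 (GLval h) (i2, im1) c +
  minor2 (GLval g) r (im2, im1) * minor2 (GLval h) (im2, im1) c +
  (minor2 (GLval g) r (i1, im1) * minor2 (GLval h) (i1, im1) c +
   minor2 (GLval g) r (i2, im2) * minor2 (GLval h) (i2, im2) c).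
  rewrite /minor2 !mulmx4E /=.
  ring: two_eq0.
by rewrite CB rg ch addrr2 addr0.
Qed.

(** This is the special isogeny, whose composite with the Frobenius map
    x |-> x^theta has the values prescribed for sigma on root elements. *)
Lemma minors_root gm xi :
  minors (x_root gm xi) = x_root (rbar gm) (xi ^+ rlambda (rbar gm)).
Proof.
have pos p : minors (x_pos p xi) = x_pos (pbar p) (xi ^+ plambda (pbar p)).
  apply/matrixP; case: p; elim/ord4P; elim/ord4P;
  by rewrite mxE /minor2 !x_posE /= !mxE /= !simp01 ?addrr2.
case: gm => p //=.
rewrite -pos; apply/matrixP => i j.
by rewrite !mxE /minor2 !mxE; congr (_ + _); rewrite mulrC.
Qed.

(** * Fixed points of the exceptional automorphism *)

Section Frobenius.

Variable m : nat.
Hypothesis hF : #|F| = (2 ^ (2 * m + 1))%N.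

Lemma theta_pnat : [pchar F].-nat (theta m).
Proof. by rewrite pnatX (pnatE _ (isT : prime 2)) char2. Qed.

(** The Tits endomorphism of F: as 2 theta^2 = q, its square is x |-> x^2 and
    its inverse is x |-> x^theta. *)
Definition tits x := x ^+ (2 * theta m).

Lemma titsD x y : tits (x + y) = tits x + tits y.
Proof.
apply: exprDn_pchar.
by rewrite pnatM theta_pnat andbT (pnatE _ (isT : prime 2)) char2.
Qed.

Lemma titsM x y : tits (x * y) = tits x * tits y.
Proof. exact: exprMn. Qed.

Lemma tits0 : tits 0 = 0.
Proof. by rewrite /tits expr0n muln_eq0 expn_eq0. Qed.

Lemma tits1 : tits 1 = 1.
Proof. exact: expr1n. Qed.

Lemma tits_theta x : tits (x ^+ theta m) = x.
Proof.
by rewrite -[RHS](expf_card x) hF addn1 expnS (mul2n m) -addnn expnD mulnCA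
           exprM.
Qed.

Lemma theta_tits x : tits x ^+ theta m = x.
Proof. by rewrite -exprM mulnC exprM; exact: tits_theta. Qed.

Lemma tits_tits x : tits (tits x) = x ^+ 2.
Proof.
rewrite {2}/tits mulnC exprM /tits -exprM mulnC exprM -/(tits _).
by rewrite tits_theta.
Qed.

Lemma tits_eq0 x : (tits x == 0) = (x == 0).
Proof. by rewrite expf_eq0 muln_gt0 expn_gt0. Qed.

Lemma thetaD x y : (x + y) ^+ theta m = x ^+ theta m + y ^+ theta m.
Proof. exact/exprDn_pchar/theta_pnat. Qed.

Section Sigma.

Variable sigma : {perm {'GL_4[F]}}.
Hypothesis hsigma : exceptional_aut m sigma.

Let frob A : 'M[F]_4 := map_mx (fun x => x ^+ theta m) A.

Lemma sigmaM : {in Sp4 F &, {morph sigma : g h / (g * h)%g}}.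
Proof. by have [/Aut_morphic/morphicP] := hsigma. Qed.

Lemma sigma1 : sigma 1%g = 1%g.
Proof. by apply: (mulgI (sigma 1%g)); rewrite -sigmaM ?group1 // !mulg1. Qed.

(** Both sides are multiplicative on Sp(4) and agree on root elements, which
    generate. *)
Lemma sigma_minors g : g \in Sp4 F -> GLval (sigma g) = frob (minors (GLval g)).
Proof.
pose H := [set g in Sp4 F | GLval (sigma g) == frob (minors (GLval g))].
have frobM A B : frob (A *m B) = frob A *m frob B.
  by apply/matrixP => i j; rewrite !mxE !sum_ord4 !thetaD !exprMn !mxE.
have frob_root gm xi :
    frob (x_root gm xi) = x_root gm (xi ^+ theta m).
  have pos p : frob (x_pos p xi) = x_pos p (xi ^+ theta m).
    apply/matrixP; case: p; elim/ord4P; elim/ord4P;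
    by rewrite !x_posE !mxE /= ?expr1n // expr0n expn_eq0.
  by case: gm => p /=; rewrite -pos ?map_trmx.
have Hg : group_set H.
  apply/group_setP; split.
    rewrite inE group1 sigma1 GL_1E /=; apply/eqP/matrixP.
    by elim/ord4P; elim/ord4P; rewrite !mxE /minor2 !mxE /= !simp01 ?expr1n
      ?expr0n ?expn_eq0.
  move=> x y /setIdP[xS /eqP xE] /setIdP[yS /eqP yE].
  rewrite inE groupM //=; apply/eqP.
  by rewrite sigmaM // !GL_MxE minorsM // frobM xE yE.
move=> gS; suff /subsetP/(_ g gS) : Sp4 F \subset Group Hg.
  by rewrite inE => /andP[_ /eqP].
apply: Sp4_sub_roots => gm xi x xE.
have [x' x'S x'E] := x_root_Sp4 char2 gm xi.
have -> : x = x' by apply: val_inj; rewrite [LHS]xE.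
rewrite inE x'S /=; apply/eqP; have [_ sE] := hsigma.
by rewrite (sE gm xi x' x'E) x'E minors_root frob_root exprM.
Qed.

(** Apply the inverse of x |-> x^theta to the equation sigma g = g: this gives
    the algebraic equations by which the Suzuki group is studied below. *)
Lemma mem_Sz g : (g \in Sz sigma) =
  (g \in Sp4 F) && (minors (GLval g) == map_mx tits (GLval g)).
Proof.
rewrite inE; have [gS|//] := boolP (g \in Sp4 F).
rewrite /=; apply/eqP/eqP=> [gE|gE].
  rewrite -[in RHS]gE sigma_minors //.
  by apply/matrixP => i j; rewrite [RHS]mxE [in RHS]mxE tits_theta.
apply: val_inj; rewrite [LHS]sigma_minors // gE.
by apply/matrixP => i j; rewrite !mxE theta_tits.
Qed.

Lemma Sz_group_set : group_set (Sz sigma).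
Proof.
apply/group_setP; split; first by rewrite inE group1 sigma1 /=.
move=> x y /setIdP[xS /eqP xE] /setIdP[yS /eqP yE].
by rewrite inE groupM //= sigmaM // xE yE.
Qed.

(** * The unipotent subgroup U as a vector stabilizer *)

Let K : {group {'GL_4[F]}} := Group Sz_group_set.

Lemma SzM : {in Sz sigma &, forall g h, (g * h)%g \in Sz sigma}.
Proof. exact: (groupM (G := K)). Qed.

Lemma SzV : {in Sz sigma, forall g, g^-1%g \in Sz sigma}.
Proof. by move=> g gS; rewrite (groupV K). Qed.

Let e (i : 'I_4) : 'cV[F]_4 := delta_mx i 0.

Lemma mul_e A i j : (A *m e j) i 0 = A i j.
Proof. by rewrite -colE mxE. Qed.

Lemma Sz_Sp4 g : g \in Sz sigma -> g \in Sp4 F.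
Proof. by case/setIdP. Qed.

Lemma Sz_tits g : g \in Sz sigma -> forall i j,
  tits (GLval g i j) = minor2 (GLval g) (isoPair i) (isoPair j).
Proof.
by rewrite mem_Sz => /andP[_ /eqP/matrixP gE] i j; move: (gE i j); rewrite !mxE.
Qed.

Lemma x_plus_mx t u (a := t ^+ theta m) :
  x_plus m t u = mx4
    [:: [:: 1; a; u; a ^+ 2 * t + a * u + tits u]; [:: 0; 1; t; a * t + u];
        [:: 0; 0; 1; a]; [:: 0; 0; 0; 1]].
Proof.
rewrite x_plusE //= [t ^+ (2 * _).+1]exprSr [t ^+ (theta m).+1]exprSr.
by rewrite /a -exprM (mulnC _ 2).
Qed.

Lemma x_plus_Sp4 t u : exists2 g, g \in Sp4 F & GLval g = x_plus m t u.
Proof.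
rewrite /x_plus.
have [a aS /= <-] := x_root_Sp4 char2 (Pos Alpha) (t ^+ theta m).
have [b bS /= <-] := x_root_Sp4 char2 (Pos Beta) t.
have [c cS /= <-] := x_root_Sp4 char2 (Pos AlphaBeta) (t ^+ (theta m).+1 + u).
have [d dS /= <-] := x_root_Sp4 char2 (Pos TwoAlphaBeta) (u ^+ (2 * theta m)).
by exists (a * b * c * d)%g; rewrite ?groupM // !GL_MxE.
Qed.

Lemma x_plus_Sz g t u : GLval g = x_plus m t u -> g \in Sz sigma.
Proof.
move=> gE; have [g' g'S g'E] := x_plus_Sp4 t u.
have -> : g = g' by apply: val_inj; rewrite [LHS]gE.
rewrite mem_Sz g'S /= g'E x_plus_mx; set a := t ^+ _.
have aE : tits a = t by exact: tits_theta.
have tE : tits t = a ^+ 2 by rewrite -aE tits_tits.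
apply/eqP/matrixP; elim/ord4P; elim/ord4P; rewrite mxE /minor2 !mxE /=
  ?expr2 ?(titsD, titsM, aE, tE, tits_tits, tits1, tits0); by ring: two_eq0.
Qed.

Lemma w_Sz : exists2 w, w \in Sz sigma & GLval w = w_mx F.
Proof.
have ww : w_mx F *m w_mx F = 1%:M.
  by apply/matrixP; elim/ord4P; elim/ord4P; rewrite mulmx4E !mxE /= !simp01.
have [uw _] := mulmx1_unit ww.
pose w : {'GL_4[F]} := Sub (w_mx F) uw.
exists w => //; rewrite mem_Sz inE; apply/andP; split; apply/eqP/matrixP.
  by elim/ord4P; elim/ord4P; rewrite !mulmx4E !mxE /= !simp01.
by elim/ord4P; elim/ord4P; rewrite mxE /minor2 !mxE /= ?tits1 ?tits0 !simp01.
Qed.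

(** A symplectic g that fixes the first basis vector has last row (0, 0, 0, 1);
    the equations for the minors then make g unipotent upper triangular and
    express all its entries through those in positions (2, -2) and (1, -2). *)
Lemma stab_U g : g \in Sz sigma -> GLval g *m e i1 = e i1 -> g \in U_plus F m.
Proof.
move=> gS ge; have sp := symp_col (Sz_Sp4 gS); have ti := Sz_tits gS.
have c1 i : GLval g i i1 = (i == i1)%:R by rewrite -mul_e ge mxE andbT.
have r4 j : GLval g im1 j = (i1 == rev_ord j)%:R.
  by rewrite -sp !c1 /= !simp01.
have y2 : GLval g i2 i2 = 1.
  by have := ti i1 i1; rewrite /minor2 /= !c1 /= tits1 !simp01.
have y3 : GLval g im2 i2 = 0.
  by have := ti i2 i1; rewrite /minor2 /= !c1 /= tits0 !simp01.
have z3 : GLval g im2 im2 = 1.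
  by have := sp i2 im2; rewrite !r4 /= y2 y3 !simp01.
have y1 : GLval g i1 i2 = GLval g i2 im2 ^+ theta m.
  by rewrite -[LHS]theta_tits ti /minor2 /= !c1 /= !simp01.
have c3 : GLval g im2 im1 = GLval g i1 i2.
  apply/eqP; rewrite -addr2_eq0 addrC -[X in _ == X](sp i2 im1) !r4 y2 y3 /=.
  by rewrite !simp01.
have c2 : GLval g i2 im1 = GLval g i1 i2 * GLval g i2 im2 + GLval g i1 im2.
  apply/eqP; rewrite -addr2_eq0 -[X in _ == X](sp im2 im1) !r4 z3 c3 /=.
  by rewrite !simp01; apply/eqP; ring.
rewrite inE; apply/existsP; exists (GLval g i2 im2).
apply/existsP; exists (GLval g i1 im2); rewrite x_plus_mx -y1.
apply/eqP/matrixP; elim/ord4P; elim/ord4P;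
  rewrite ?mxE /= ?c1 ?r4 ?y2 ?y3 ?z3 ?c2 ?c3 //.
rewrite ti /minor2 /= c2 y2; ring: two_eq0.
Qed.

(** This description shows at once that U is a group. *)
Lemma mem_U g :
  (g \in U_plus F m) = (g \in Sz sigma) && (GLval g *m e i1 == e i1).
Proof.
apply/idP/andP=> [|[gS /eqP]]; last exact: stab_U.
rewrite inE => /existsP[t /existsP[u /eqP gE]]; split.
  exact: x_plus_Sz gE.
apply/eqP/matrixP=> i j; rewrite ord1 mul_e gE x_plus_mx !mxE andbT.
by elim/ord4P: i.
Qed.

Lemma U_group_set : group_set (U_plus F m).
Proof.
apply/group_setP; split.
  by rewrite mem_U (group1 K) GL_1E mul1mx eqxx.
move=> x y; rewrite !mem_U => /andP[xS /eqP xE] /andP[yS /eqP yE].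
apply/andP; split; first exact: SzM.
by rewrite GL_MxE -mulmxA yE xE.
Qed.

Let U : {group {'GL_4[F]}} := Group U_group_set.

(** * Orbits on the ovoid *)

(** The first column x of g lies on the Suzuki-Tits ovoid. By [Sz_tits] the
    Tits images of x are minors of the first two columns; after substituting
    them, the expression is x_{-2} x_{-1} times the symplectic product of these
    two columns, which are orthogonal. *)
Lemma ovoid_eq g : g \in Sz sigma ->
  let x i := GLval g i i1 in
  x im1 ^+ 2 * tits (x i2) + x im2 ^+ 2 * tits (x im2) +
  (x i2 * x im2 + x i1 * x im1) * tits (x im1) = 0.
Proof.
move=> gS x; rewrite /x !Sz_tits // /minor2 /=.
have s12 := symp_col (Sz_Sp4 gS) i1 i2; rewrite /= in s12.
rewrite -[RHS](mulr0 (GLval g im2 i1 * GLval g im1 i1)) -[X in _ = _ * X]s12.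
ring: two_eq0.
Qed.

(** U acts transitively on the points of the ovoid outside the hyperplane
    x_{-1} = 0, since they are the last columns of the matrices [x_plus]: the
    parameters t and u are read off from the coordinates x_{-2} and x_2, and
    [ovoid_eq] forces the coordinate x_1. *)
Lemma ovoid_U g : g \in Sz sigma -> GLval g im1 i1 != 0 ->
  exists2 y, y \in U &
    GLval g *m e i1 = GLval g im1 i1 *: (GLval y *m e im1).
Proof.
move=> gS; have := ovoid_eq gS; rewrite /=.
set x1 := GLval g i1 i1; set x2 := GLval g i2 i1.
set x3 := GLval g im2 i1; set x4 := GLval g im1 i1 => ov nz.
have [a aE] : exists a, x3 = x4 * a by exists (x3 / x4); rewrite mulrC divfK.
have [b bE] : exists b, x2 = x4 * b by exists (x2 / x4); rewrite mulrC divfK.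
have [y _ yE] := x_plus_Sp4 (tits a) (b + a * tits a).
exists y.
  by rewrite /= inE; apply/existsP; exists (tits a); apply/existsP;
     exists (b + a * tits a); rewrite yE.
have x1E : x1 = x4 * (tits b + a ^+ 2 * tits a + a * b).
  apply/eqP; rewrite -addr2_eq0.
  (* The ovoid equation determines x1 only up to this nonzero factor. *)
  have/eqP : x4 * tits x4 *
      (x1 + x4 * (tits b + a ^+ 2 * tits a + a * b)) = 0.
    by rewrite -[RHS]ov aE bE !titsM; ring.
  by rewrite !mulf_eq0 tits_eq0 (negPf nz).
apply/matrixP=> i j; rewrite ord1 mul_e mxE mul_e yE x_plus_mx theta_tits mxE.
elim/ord4P: i => /=; rewrite -/x1 -/x2 -/x3 -/x4.
- rewrite x1E titsD titsM tits_tits -[LHS]addr0.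
  by rewrite -(addrr2 (x4 * a ^+ 2 * tits a)); ring.
- rewrite bE; ring: two_eq0.
- by rewrite aE.
- by rewrite mulr1.
Qed.

(** By [ovoid_U], elements y and z of U carry c e_{-1} to the first columns of
    g and h, where c is the common entry in position (-1, 1). So
    h^-1 z y^-1 g fixes e_1, that is, lies in U. *)
Lemma same_corner g h : g \in Sz sigma -> h \in Sz sigma ->
  GLval g im1 i1 != 0 -> GLval g im1 i1 = GLval h im1 i1 ->
  exists a b, [/\ a \in U, b \in U & g = (a * h * b)%g].
Proof.
move=> gS hS nz gh; have [y yU yE] := ovoid_U gS nz.
have [z zU zE] := ovoid_U hS (etrans (congr1 (fun x => x != 0) (esym gh)) nz).
have mK (k : {'GL_4[F]}) (v : 'cV[F]_4) : GLval k^-1%g *m (GLval k *m v) = v.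
  by rewrite mulmxA -GL_MxE mulVg GL_1E mul1mx.
have US (k : {'GL_4[F]}) : k \in U -> k \in Sz sigma.
  by rewrite /= mem_U => /andP[].
exists (y * z^-1)%g, (h^-1 * z * y^-1 * g)%g; split.
- by rewrite groupM ?groupV.
- rewrite /= mem_U; apply/andP; split.
    exact: SzM (SzM (SzM (SzV hS) (US _ zU)) (SzV (US _ yU))) gS.
  by rewrite !GL_MxE -!mulmxA yE -!scalemxAr mK gh scalemxAr -zE mK.
- by rewrite !mulgA mulgK mulgVK mulgV mul1g.
Qed.

(** * The factorization *)

Lemma U_minus_Sz g : g \in U_minus F m -> g \in Sz sigma.
Proof.
rewrite inE => /existsP[t /existsP[u /eqP gE]].
have [w wS wE] := w_Sz; have [x _ xE] := x_plus_Sp4 t u.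
have -> : g = (w * x * w)%g.
  by apply: val_inj; rewrite [LHS]gE [RHS]GL_MxE GL_MxE wE xE.
exact: SzM (SzM wS (x_plus_Sz xE)) wS.
Qed.

(** The elements with t = 0: their entry in position (-1, 1), the Tits image of
    u, takes every value in F. *)
Lemma U_minus_corner u : exists2 v, v \in U_minus F m &
  forall i, GLval v i i1 = nth 0 [:: 1; 0; u; tits u] i.
Proof.
have [w wS wE] := w_Sz; have [x _ xE] := x_plus_Sp4 0 u.
have vE : GLval (w * x * w)%g = w_mx F *m x_plus m 0 u *m w_mx F.
  by rewrite !GL_MxE wE xE.
exists (w * x * w)%g => [|i].
  by rewrite inE; apply/existsP; exists 0; apply/existsP; exists u; rewrite vE.
rewrite vE x_plus_mx expr0n expn_eq0 /=.
by elim/ord4P: i; rewrite !mulmx4E !mxE /= !simp01.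
Qed.

(** U^- contains an element with the same corner entry as g, and
    [same_corner] applies to the two. *)
Lemma corner_UVU g : g \in Sz sigma -> GLval g im1 i1 != 0 ->
  exists a v b, [/\ a \in U, v \in U_minus F m, b \in U & g = (a * v * b)%g].
Proof.
move=> gS nz; have [v vU vE] := U_minus_corner (GLval g im1 i1 ^+ theta m).
have [|a [b [aU bU ->]]] := same_corner gS (U_minus_Sz vU) nz.
  by rewrite vE /= tits_theta.
by exists a, v, b.
Qed.

(** If x_{-1} = 0 then the ovoid equation gives x_{-2} = 0, and the minors give
    x_2 = 0. Thus g fixes the line of e_1, hence its orthogonal hyperplane, and
    the last row of g is zero off the diagonal. *)
Lemma corner0_row g : g \in Sz sigma -> GLval g im1 i1 = 0 ->
  GLval g im1 im2 = 0 /\ GLval g im1 im1 != 0.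
Proof.
move=> gS x4; have sp := symp_col (Sz_Sp4 gS).
have x3 : GLval g im2 i1 = 0.
  have := ovoid_eq gS; rewrite /= x4 tits0 expr2 !simp01 => /eqP.
  by rewrite mulf_eq0 tits_eq0 expf_eq0 /= orbb => /eqP.
have x2 : GLval g i2 i1 = 0.
  apply/eqP; apply/negPn/negP=> nz.
  have y3 : GLval g im2 i2 = 0.
    have /eqP := sp i1 i2; rewrite x3 x4 /= !simp01.
    have /eqP := Sz_tits gS im2 i1.
    rewrite /minor2 /= x3 x4 tits0 !simp01 eq_sym mulf_eq0 (negPf nz) /=.
    move=> /eqP->.
    by rewrite mulr0 add0r mulf_eq0 (negPf nz) => /eqP.
  have := Sz_tits gS i2 i1; rewrite /minor2 /= x3 y3 !simp01 => /eqP.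
  by rewrite tits_eq0 (negPf nz).
have s k : GLval g i1 i1 * GLval g im1 k = (i1 == rev_ord k)%:R.
  by rewrite -sp x2 x3 x4 !simp01.
have nz : GLval g i1 i1 * GLval g im1 im1 != 0 by rewrite s oner_eq0.
move: nz; rewrite mulf_eq0 negb_or => /andP[x1 ->]; split=> //.
by apply/eqP; have /eqP := s im2; rewrite mulf_eq0 (negPf x1).
Qed.

(** If the corner entry of g vanishes, v with t = 0 and u = 1 turns it into the
    last diagonal entry of g. *)
Lemma corner_neq0 g : g \in Sz sigma ->
  exists2 v, v \in U_minus F m & GLval (g * v)%g im1 i1 != 0.
Proof.
move=> gS; have [x4|nz] := eqVneq (GLval g im1 i1) 0.
  have [v vU vE] := U_minus_corner 1; have [g43 g44] := corner0_row gS x4.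
  exists v => //; rewrite GL_MxE mulmx4E !vE /= x4 g43 tits1 !simp01.
  exact: g44.
have [v vU vE] := U_minus_corner 0; exists v => //.
by rewrite GL_MxE mulmx4E !vE /= tits0 !simp01.
Qed.

Lemma U_minusV v : v \in U_minus F m -> (v^-1)%g \in U_minus F m.
Proof.
rewrite inE => /existsP[t /existsP[u /eqP vE]].
have [w _ wE] := w_Sz; have [x _ xE] := x_plus_Sp4 t u.
have xU : x \in U.
  rewrite /= inE; apply/existsP; exists t; apply/existsP; exists u.
  by rewrite xE.
have ww : (w^-1 = w)%g.
  apply/eqP; rewrite eq_invg_mul; apply/eqP/val_inj.
  rewrite [LHS]GL_MxE wE; apply/matrixP; elim/ord4P; elim/ord4P;
  by rewrite mulmx4E !mxE /= !simp01.
have -> : v = (w * x * w)%g.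
  by apply: val_inj; rewrite [LHS]vE [RHS]GL_MxE GL_MxE wE xE.
rewrite -groupV in xU; move: xU.
rewrite !invMg ww /= inE => /existsP[t' /existsP[u' /eqP xV]].
rewrite inE; apply/existsP; exists t'; apply/existsP; exists u'.
by rewrite mulgA !GL_MxE wE xV.
Qed.

(** Move g by an element v of U^- to a nonzero corner entry, factor g v as an
    element of U U^- U, and move v^-1 to the right. *)
Lemma Sz_UVUV : Sz sigma =
  (U_plus F m * U_minus F m * U_plus F m * U_minus F m)%g.
Proof.
have US g : g \in U_plus F m -> g \in Sz sigma by rewrite mem_U => /andP[].
apply/setP=> g; apply/idP/idP=> [gS|].
  have [v vU nz] := corner_neq0 gS.
  have gvS : (g * v)%g \in Sz sigma.
    by apply: SzM => //; exact: U_minus_Sz.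
  have [a [v1 [b [aU v1U bU gvE]]]] := corner_UVU gvS nz.
  rewrite -[g](mulgK v) gvE; apply: mem_mulg; last exact: U_minusV.
  by apply: mem_mulg bU; exact: mem_mulg.
case/mulsgP=> h v + vU ->; case/mulsgP=> h' b + bU ->.
case/mulsgP=> a v' aU v'U ->.
exact: SzM (SzM (SzM (US _ aU) (U_minus_Sz v'U)) (US _ bU)) (U_minus_Sz vU).
Qed.

End Sigma.
End Frobenius.
End Suzuki.

Theorem lemma1 (F : finFieldType) (m : nat) (sigma : {perm {'GL_4[F]}})
    (hF : #|F| = (2 ^ (2 * m + 1))%N)
    (hsigma : exceptional_aut m sigma) :
  Sz sigma = (U_plus F m * U_minus F m * U_plus F m * U_minus F m)%g.
Proof. exact: Sz_UVUV (card_finPcharP hF isT) m hF sigma hsigma. Qed.
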